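(* Let $n\ge 1$ and $r\ge 1$ be integers. For any graph $G$ with $n$ vertices and clique number $\omega(G)\le r$, and for each $k\in\{2,\ldots,r\}$, one has $$\frac{c_r(G)}{t_r(n,r)}\leq\ldots\leq\frac{c_k(G)}{t_k(n,r)}\leq\frac{c_{k-1}(G)}{t_{k-1}(n,r)}\leq\ldots\leq\frac{c_2(G)}{t_2(n,r)}\leq 1.$$
   Context: Graphs are finite, without loops or multiple edges. A $k$-clique of a graph $G$ is a complete induced subgraph of $G$ with exactly $k$ vertices, $c_k(G)$ is the number of $k$-cliques of $G$, and $\omega(G)$ is the largest $k$ for which $G$ has a $k$-clique. The Turán graph $T(n,r)$ is the complete $r$-partite graph on $n$ vertices whose parts have sizes as equal as possible (any two part sizes differ by at most $1$; if $n<r$ some parts are empty). $t_k(n,r)=c_k(T(n,r))$ is the number of $k$-cliques in $T(n,r)$. Only ratios with nonzero denominator, i.e. those with index at most $\min(n,r)$, are considered; when $r\le n$ these are all the ratios in the chain. *)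

(* Defs.v *)
From mathcomp Require Import all_boot all_order all_algebra.

Set Implicit Arguments.
Unset Strict Implicit.
Unset Printing Implicit Defensive.

Record sgraph := SGraph {
  vertex :> finType;
  adj : rel vertex;
  adj_sym : symmetric adj;
  adj_irrefl : irreflexive adj
}.

(* An induced subgraph is identified with its set of vertices. *)
Definition clique (G : sgraph) (A : {set G}) : bool :=
  [forall x in A, forall y in A, (x != y) ==> adj x y].

Definition nb_cliques (k : nat) (G : sgraph) : nat :=
  #|[set A : {set G} | clique A & #|A| == k]|.

Definition clique_number (G : sgraph) : nat :=
  \max_(A : {set G} | clique A) #|A|.

(* The r parts of the Turán graph are the residue classes modulo r in
   {0, ..., n-1}; see card_turan_part for their sizes. *)
Definition turan_adj (n r : nat) : rel 'I_n :=
  fun i j => i != j %[mod r].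

Fact turan_adj_sym n r : symmetric (@turan_adj n r).
Proof. by move=> i j; rewrite /turan_adj eq_sym. Qed.

Fact turan_adj_irrefl n r : irreflexive (@turan_adj n r).
Proof. by move=> i; rewrite /turan_adj eqxx. Qed.

Definition turan_graph (n r : nat) : sgraph :=
  SGraph (@turan_adj_sym n r) (@turan_adj_irrefl n r).

Definition turan_cliques (k n r : nat) : nat := nb_cliques k (turan_graph n r).

Lemma card_turan_part (n r : nat) (c : 'I_r) :
  #|[set i : 'I_n | i %% r == c]| = n %/ r + (c < n %% r).
Proof.
have r0 : 0 < r by apply: leq_ltn_trans (ltn_ord c).
rewrite -sum1_card (eq_bigl (fun i : 'I_n => i %% r == c)); last first.
  by move=> i; rewrite inE.
rewrite -(big_mkord (fun i => i %% r == c) (fun=> 1)).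
elim: n => [|n IHn]; first by rewrite big_geq // div0n mod0n.
rewrite big_mkcond big_nat_recr //= -big_mkcond IHn.
have -> : (if n %% r == c then 1 else 0) = (n %% r == c) by case: eqP.
have -> : n %/ r + (c < n %% r) + (n %% r == c) = n %/ r + (c < (n %% r).+1).
  by rewrite -addnA ltnS; case: ltngtP.
rewrite divnS // modnS; case: ifP => // dvd_rn.
suff -> : (n %% r).+1 = r by rewrite ltn_ord addn0 addnC.
apply/eqP; rewrite eqn_leq ltn_pmod //= dvdn_leq //.
by move: dvd_rn; rewrite {1}(divn_eq n r) -addnS dvdn_addr // dvdn_mull.
Qed.

Lemma turan_cliques_gt0 (k n r : nat) :
  0 < r -> (0 < turan_cliques k n r) = (k <= minn n r).
Proof.
move=> r0; apply/card_gt0P/idP => [[A]|].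
  rewrite inE => /andP[/forall_inP cA /eqP <-].
  have An : #|A| <= n by rewrite -[X in _ <= X](card_ord n) max_card.
  rewrite leq_min An /=.
  pose f (i : 'I_n) : 'I_r := Ordinal (ltn_pmod i r0).
  have inj : {in A &, injective f}.
    move=> x y xA yA /(congr1 val) /= e; apply/eqP/negP => /negP ne.
    have /forall_inP/(_ y yA)/implyP/(_ ne) := cA x xA.
    by rewrite /= /turan_adj e eqxx.
  by rewrite -(card_in_imset inj) -[X in _ <= X]card_ord max_card.
rewrite leq_min => /andP[kn kr].
exists [set widen_ord kn i | i : 'I_k]; rewrite inE; apply/andP; split.
  apply/forall_inP => _ /imsetP[i _ ->]; apply/forall_inP => _ /imsetP[j _ ->].
  apply/implyP => ne; rewrite /= /turan_adj /=.
  by rewrite !modn_small ?(leq_trans (ltn_ord _) kr).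
by rewrite card_imset ?card_ord // => i j /(congr1 val) /= /val_inj.
Qed.

(* Main.v *)
Require Import Defs.
From mathcomp Require Import all_boot all_order all_algebra.
From mathcomp Require Import zify ring lra.

Set Implicit Arguments.
Unset Strict Implicit.
Unset Printing Implicit Defensive.

Import Order.TTheory GRing.Theory Num.Theory.

(** The inequality between consecutive ratios says that the linear form
    c_k(G) t_{k-1} - c_{k-1}(G) t_k is nonpositive.  Zykov's symmetrization,
    in the weighted shape of Motzkin and Straus, reduces it to complete
    multipartite graphs.  Give every vertex v a weight w v and count a clique A
    with multiplicity \prod_(v in A) w v; for natural weights this counts the
    cliques of the blow-up of G in which v becomes w v independent copies.  When
    u and v are distinct and not adjacent, no clique contains both, so any
    linear form in the weighted clique numbers is affine along the exchange of
    weight between u and v.  Hence one of the two moves, all the weight to u or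
    all of it to v, does not decrease the form (wcliques_transfer).  Starting from weights 1
    and repeating, the support becomes a clique, hence has at most r elements,
    and the weighted clique numbers become the elementary symmetric numbers e_k
    of r naturals with sum n (nb_cliques_le_elsym).

    It remains to see that e_k / e_{k-1} is largest, among r naturals of fixed
    sum, when the numbers differ by at most one.  Replacing two entries a and b
    with b + 2 <= a by a - 1 and b + 1 keeps their sum and increases their
    product, and e_k / e_{k-1} is a nondecreasing function of that product
    because the elementary symmetric numbers of the other entries are
    log-concave (elsym_ratio_smooth).  This process ends at a balanced
    sequence, which is unique up to order, so it is the sequence of part sizes
    of the Turan graph, whose k-cliques are counted by e_k
    (turan_cliquesE).

    The last inequality is the case k = 2 of the chain, since a graph on n
    vertices has n cliques of size 1. *)

(** * Elementary symmetric numbers of a sequence of naturals *)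

Definition elsym_poly (s : seq nat) : {poly rat} :=
  (\prod_(x <- s) (1 + x%:R *: 'X))%R.

Definition elsym (k : nat) (s : seq nat) : rat := ((elsym_poly s)`_k)%R.

Section ElementarySymmetric.
Local Open Scope ring_scope.

Lemma elsym_perm k s t : perm_eq s t -> elsym k s = elsym k t.
Proof. by move=> st; rewrite /elsym /elsym_poly (perm_big _ st). Qed.

Lemma elsym_nil k : elsym k [::] = (k == 0%N)%:R.
Proof. by rewrite /elsym /elsym_poly big_nil coef1. Qed.

Lemma elsym_cons0 x s : elsym 0 (x :: s) = elsym 0 s.
Proof.
by rewrite /elsym /elsym_poly big_cons mulrDl mul1r coefD -scalerAl coefZ coefXM
   mulr0 addr0.
Qed.

Lemma elsym_consS k x s : elsym k.+1 (x :: s) = elsym k.+1 s + x%:R * elsym k s.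
Proof.
by rewrite /elsym /elsym_poly big_cons mulrDl mul1r coefD -scalerAl coefZ coefXM.
Qed.

Lemma elsym0 s : elsym 0 s = 1.
Proof. by elim: s => [|x s IHs]; rewrite ?elsym_nil // elsym_cons0. Qed.

Lemma elsym_ge0 k s : 0 <= elsym k s.
Proof.
elim: s k => [|x s IHs] [|k]; rewrite ?elsym_nil ?ler0n ?elsym_cons0 //.
by rewrite elsym_consS addr_ge0 // mulr_ge0 // ler0n.
Qed.

Lemma elsym_eq0S k s : elsym k s = 0 -> elsym k.+1 s = 0.
Proof.
elim: s k => [|x s IHs] k; first by rewrite !elsym_nil.
case: k => [|k]; first by rewrite elsym0 => /eqP; rewrite oner_eq0.
rewrite !elsym_consS => e.
have h1 := elsym_ge0 k.+1 s.
have h2 : 0 <= x%:R * elsym k s by rewrite mulr_ge0 ?elsym_ge0.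
have e1 : elsym k.+1 s = 0 by lra.
by rewrite e1 mulr0 addr0 IHs.
Qed.

(** Newton's inequality in its weak form, with two indices rather than one: this
    stronger form passes to x :: s, because multiplying by 1 + x X only needs
    instances of it with neighbouring indices. *)
Lemma elsym_logconcave i j s : (i <= j)%N ->
  elsym i s * elsym j.+1 s <= elsym i.+1 s * elsym j s.
Proof.
elim: s i j => [|x s IHs] i j ij.
  by rewrite !elsym_nil mulr0 mul0r.
have x0 : 0 <= x%:R :> rat by rewrite ler0n.
have p0 k := elsym_ge0 k s.
case: j i ij => [|j] [|i] // ij.
- by rewrite mulrC.
- rewrite !elsym_cons0 !elsym_consS elsym0.
  have := IHs 0%N j.+1 isT; rewrite elsym0.
  have := mulr_ge0 x0 (mulr_ge0 (p0 1%N) (p0 j)).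
  have := mulr_ge0 x0 (mulr_ge0 x0 (p0 j)).
  nra.
rewrite !elsym_consS.
have h1 := IHs _ _ ij.
(* The indices i, j+2 are brought to i+1, j+1 and then to i+2, j; when i = j *)
(* the last move is impossible, but then the two sides agree. *)
have h2 : elsym i s * elsym j.+2 s <= elsym i.+2 s * elsym j s.
  move: ij; rewrite ltnS leq_eqVlt => /orP[/eqP<-|ij].
    by rewrite mulrC.
  apply: le_trans (IHs i.+1 j ij).
  by apply: IHs; lia.
have h3 : elsym i s * elsym j.+1 s <= elsym i.+1 s * elsym j s by apply: IHs.
have := ler_wpM2l x0 h2.
have := ler_wpM2l x0 (ler_wpM2l x0 h3).
lra.
Qed.

(** The ratio is 0 when its denominator vanishes, which agrees with the fact that
    elsym k.+1 s is then 0 as well (elsym_eq0S). *)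
Definition elsym_ratio k s := elsym k.+1 s / elsym k s.

Lemma elsym_cons2 k a b s :
  elsym k.+2 [:: a, b & s] =
    elsym k.+2 s + (a + b)%:R * elsym k.+1 s + (a * b)%:R * elsym k s.
Proof. by rewrite !elsym_consS natrD natrM; ring. Qed.

Lemma elsym_cons2_1 a b s :
  elsym 1 [:: a, b & s] = elsym 1 s + (a + b)%:R.
Proof. by rewrite !elsym_consS elsym_cons0 elsym0 natrD; ring. Qed.

(** As a function of the product P of the first two entries, with their sum
    fixed, the ratio is the quotient of two affine functions of P, and
    log-concavity of the tail gives the sign of its determinant. *)
Lemma elsym_ratio_smooth k a b s : (b + 2 <= a)%N ->
  elsym_ratio k.+1 [:: a, b & s] <= elsym_ratio k.+1 [:: a.-1, b.+1 & s].
Proof.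
move=> ab.
have eS : (a.-1 + b.+1 = a + b)%N by lia.
have P_lt : (a * b <= a.-1 * b.+1)%N by nia.
rewrite /elsym_ratio.
move: P_lt; rewrite -(ler_nat rat).
(* For k = 0 the denominator is the sum of the entries, which does not move. *)
case: k => [|k].
  rewrite !elsym_cons2 !elsym_cons2_1 eS elsym0 !mulr1 => P_lt.
  apply: ler_wpM2r; last by rewrite lerD2l.
  by rewrite invr_ge0 addr_ge0 ?elsym_ge0.
rewrite !elsym_cons2 eS.
move: (a + b)%:R (a * b)%:R (a.-1 * b.+1)%:R (ler0n rat (a + b))
  (ler0n rat (a * b)) => S P Q S0 P0 PQ.
have h1 := elsym_logconcave s (leqnSn k).
have h2 := @elsym_logconcave k k.+2 s (leqW (leqnSn k)).
move: (elsym k s) (elsym k.+1 s) (elsym k.+2 s) (elsym k.+3 s) (elsym_ge0 k s)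
  (elsym_ge0 k.+1 s) (elsym_ge0 k.+2 s) (elsym_ge0 k.+3 s) h1 h2
  => C A B D C0 A0 B0 D0 h1 h2.
have Q0 := le_trans P0 PQ.
have SA0 := mulr_ge0 S0 A0; have SB0 := mulr_ge0 S0 B0.
have PC0 := mulr_ge0 P0 C0; have QA0 := mulr_ge0 Q0 A0.
have PQC : P * C <= Q * C by rewrite ler_wpM2r.
have d0 : 0 <= B + S * A + P * C by lra.
move: d0; rewrite le_eqVlt => /predU1P[<-|d0].
  by rewrite invr0 mulr0 divr_ge0 //; lra.
rewrite ler_pdivrMr // mulrAC ler_pdivlMr; last by lra.
have Sh1 := ler_wpM2l S0 h1.
(* The difference of the two sides factors through the change of the product. *)
rewrite -subr_ge0.
have -> : (D + S * B + Q * A) * (B + S * A + P * C) -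
          (D + S * B + P * A) * (B + S * A + Q * C) =
  (Q - P) * (S * (A * A - C * B) + (A * B - C * D)) by ring.
by apply: mulr_ge0; lra.
Qed.

End ElementarySymmetric.

(** * Balanced sequences maximize the ratios *)

Definition balanced (s : seq nat) := {in s &, forall x y, x <= y.+1}.

(** With m the least entry, every entry is m or m + 1, and m + 1 does not fill
    the whole sequence; so the sum is m * size s + a with a < size s, and m and
    a are recovered by Euclidean division. *)
Lemma balanced_perm_nseq s : 0 < size s -> balanced s ->
  let q := sumn s %/ size s in let a := sumn s %% size s in
  perm_eq s (nseq a q.+1 ++ nseq (size s - a) q).
Proof.
move=> s0 bal.
have hasm : exists m, m \in s by exists (nth 0 s 0); rewrite mem_nth.
set m := ex_minn hasm; have [ms minm] : m \in s /\ forall x, x \in s -> m <= x.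
  by rewrite /m; case: ex_minnP.
set a := count (pred1 m.+1) s.
have sE : perm_eq s (nseq a m.+1 ++ nseq (size s - a) m).
  rewrite -(perm_filterC (pred1 m.+1)) perm_sym.
  have /all_pred1P-> := filter_all (pred1 m.+1) s.
  suff /all_pred1P-> : all (pred1 m) (filter (predC (pred1 m.+1)) s).
    by rewrite !size_filter -(count_predC (pred1 m.+1) s) addKn.
  apply/allP => x; rewrite mem_filter => /andP[/= xm xs] /=.
  have := minm x xs; have := bal x m xs ms; lia.
have a_lt : a < size s.
  rewrite -(count_predC (pred1 m.+1) s) -[X in X < _]addn0 ltn_add2l -has_count.
  by apply/hasP; exists m => //=; lia.
have sumE : sumn s = m * size s + a.
  by rewrite (perm_sumn sE) sumn_cat !sumn_nseq; nia.
by rewrite sumE divnMDl // modnMDl divn_small // addn0 modn_small.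
Qed.

Lemma balanced_perm s t : balanced s -> balanced t ->
  size s = size t -> sumn s = sumn t -> perm_eq s t.
Proof.
move=> bs bt est sst; have [s0|s0] := posnP (size s).
  by move: est; rewrite s0 => /esym/size0nil->; rewrite (size0nil s0).
have := balanced_perm_nseq s0 bs; rewrite est sst => /permPl->.
by rewrite perm_sym; apply: balanced_perm_nseq; rewrite -?est.
Qed.

(** Smoothing terminates because it decreases the sum of the squares. *)
Lemma elsym_ratio_le_balanced k s t : balanced t ->
  size s = size t -> sumn s = sumn t ->
  (elsym_ratio k.+1 s <= elsym_ratio k.+1 t)%R.
Proof.
move=> bt.
have [N] := ubnP (\sum_(x <- s) x ^ 2).
elim: N s => // N IHN s; rewrite ltnS => sN est sst.
have [/allrelP bs|] := boolP (allrel (fun x y => x <= y.+1) s s).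
  by rewrite /elsym_ratio !(elsym_perm _ (balanced_perm bs bt est sst)).
case/allPn => a aS /allPn[b bS] /=; rewrite -ltnNge => ab.
have bS' : b \in rem a s.
  by move: bS; rewrite (perm_mem (perm_to_rem aS)) inE => /predU1P[|//]; lia.
have sE : perm_eq s [:: a, b & rem b (rem a s)].
  by rewrite (permPl (perm_to_rem aS)) perm_cons perm_to_rem.
set u := rem b _ in sE.
rewrite /elsym_ratio !(elsym_perm _ sE); apply: le_trans (_ : _ <= elsym_ratio k.+1 [:: a.-1, b.+1 & u])%R _.
  by apply: elsym_ratio_smooth; lia.
apply: IHN.
- apply: leq_trans sN; rewrite (perm_big _ sE) !big_cons /= !addnA ltn_add2r; nia.
- by rewrite -est (perm_size sE).
- by rewrite -sst (perm_sumn sE) /=; lia.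
Qed.

(** * Elementary symmetric numbers as sums over subsets *)

Section ElsymSets.
Local Open Scope ring_scope.

Lemma elsym_poly_sum_sets (T : finType) (w : T -> nat) :
  \prod_(v : T) (1 + (w v)%:R *: 'X) =
  \sum_(A : {set T}) (\prod_(v in A) (w v)%:R) *: 'X^#|A| :> {poly rat}.
Proof.
under eq_bigr do rewrite addrC.
rewrite bigA_distr; apply: eq_bigr => A _.
rewrite -big_mkcond /= scaler_prod prodr_const //.
Qed.

Lemma elsym_sum_sets (T : finType) (w : T -> nat) k :
  elsym k [seq w v | v <- enum T] =
  \sum_(A : {set T} | #|A| == k) \prod_(v in A) (w v)%:R.
Proof.
rewrite /elsym /elsym_poly big_map big_enum /= elsym_poly_sum_sets coef_sum.
rewrite [RHS]big_mkcond; apply: eq_bigr => A _.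
by rewrite coefZ coefXn eq_sym; case: eqP => _; rewrite ?mulr1 ?mulr0.
Qed.

Lemma elsym_filter_nz k s : elsym k [seq x <- s | x != 0%N] = elsym k s.
Proof.
suff sE : elsym_poly [seq x <- s | x != 0%N] = elsym_poly s by rewrite /elsym sE.
rewrite /elsym_poly big_filter big_mkcond.
by apply: eq_bigr => -[|x] _ //=; rewrite scale0r addr0.
Qed.

Lemma elsym_cat0 k s m : elsym k (s ++ nseq m 0%N) = elsym k s.
Proof.
by rewrite -elsym_filter_nz filter_cat filter_nseq /= cats0 elsym_filter_nz.
Qed.

End ElsymSets.

(** * Weighted cliques and the transfer of weights *)

Section WeightedCliques.
Local Open Scope ring_scope.
Variable (G : sgraph).

(** A linear form in the weighted clique numbers: c gives the coefficient of the
    weighted number of k-cliques, for each k. *)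
Definition wcliques (c : nat -> rat) (w : G -> nat) : rat :=
  \sum_(A : {set G} | clique A) c #|A| * \prod_(v in A) (w v)%:R.

Definition transfer (u v : G) (w : G -> nat) : G -> nat :=
  fun x => if x == u then (w u + w v)%N else if x == v then 0%N else w x.

(** The value at w is the barycentre, with weights w u and w v, of the values at
    the two extreme transfers.  The identity holds for each clique separately:
    a clique meets the pair u, v in at most one vertex. *)
Lemma wcliques_transfer c w (u v : G) : u != v -> ~~ adj u v ->
  (w u + w v)%:R * wcliques c w =
  (w u)%:R * wcliques c (transfer u v w) + (w v)%:R * wcliques c (transfer v u w).
Proof.
move=> uv nadj; rewrite !mulr_sumr -big_split /=; apply: eq_bigr => A cA.
have notboth : ~~ ((u \in A) && (v \in A)).
  apply/negP => /andP[uA vA]; case/negP: nadj.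
  by have /forall_inP/(_ v vA)/implyP/(_ uv) := forall_inP cA u uA.
have off (x y : G) : x \notin A -> y \notin A ->
    \prod_(z in A) (transfer x y w z)%:R = \prod_(z in A) (w z)%:R :> rat.
  move=> xA yA; apply: eq_bigr => z zA; rewrite /transfer.
  by case: eqP zA xA => [->->//|_]; case: eqP => [->zA|//]; rewrite zA in yA.
have zero (x y : G) : x != y -> y \in A ->
    \prod_(z in A) (transfer x y w z)%:R = 0 :> rat.
  move=> xy yA; rewrite (bigD1 y) //= /transfer eq_sym (negPf xy) eqxx mul0r //.
have one (x y : G) : x \in A -> y \notin A ->
    (w x)%:R * \prod_(z in A) (transfer x y w z)%:R =
    (w x + w y)%:R * \prod_(z in A) (w z)%:R :> rat.
  move=> xA yA; rewrite !(bigD1 x xA) /= {1}/transfer eqxx.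
  have -> : \prod_(z in A | z != x) (transfer x y w z)%:R =
            \prod_(z in A | z != x) (w z)%:R :> rat.
    apply: eq_bigr => z /andP[zA zx]; rewrite /transfer (negPf zx).
    by case: eqP zA yA => [->->|].
  by ring.
have [uA|uA] := boolP (u \in A); have [vA|vA] := boolP (v \in A).
- by rewrite uA vA in notboth.
- rewrite (zero v u) // 1?eq_sym // !mulr0 addr0.
  by rewrite mulrCA -(one u v) // mulrCA.
- rewrite (zero u v) // !mulr0 add0r.
  by rewrite mulrCA addnC -(one v u) // mulrCA.
- by rewrite !off // natrD mulrDl.
Qed.

Lemma sum_transfer w (u v : G) : u != v ->
  (\sum_x transfer u v w x = \sum_x w x)%N.
Proof.
move=> uv.
have sumD f : (\sum_x f x = f u + f v + \sum_(x | (x != u) && (x != v)) f x)%N.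
  by rewrite (bigD1 u) //= (bigD1 v) 1?eq_sym //= addnA.
rewrite !sumD /transfer !eqxx [v == u]eq_sym (negPf uv) addn0.
congr (_ + _)%N.
by apply: eq_bigr => x /andP[/negPf-> /negPf->].
Qed.

Lemma supp_transfer w (u v : G) : u != v -> (0 < w u)%N -> (0 < w v)%N ->
  (#|[set x | transfer u v w x != 0%N]| < #|[set x | w x != 0%N]|)%N.
Proof.
move=> uv u0 v0; apply: proper_card; apply/properP; split.
  apply/subsetP => x; rewrite !inE /transfer.
  by case: (x =P u) => [->|_]; [rewrite -!lt0n|case: (x =P v)].
exists v; rewrite !inE; first by rewrite -lt0n.
by rewrite /transfer [v == u]eq_sym (negPf uv) eqxx.
Qed.

(** Both orientations of a transfer within the support make it smaller, and one
    of them does not decrease the form, by the barycentre identity. *)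
Lemma wcliques_le_clique_support c (w : G -> nat) :
  exists w' : G -> nat, [/\ clique [set x | w' x != 0%N],
    (\sum_x w' x = \sum_x w x)%N & wcliques c w <= wcliques c w'].
Proof.
have [N] := ubnP #|[set x | w x != 0%N]|.
elim: N w => // N IHN w; rewrite ltnS => wN.
have [cl|] := boolP (clique [set x | w x != 0%N]); first by exists w.
case/forall_inPn => u; rewrite inE -lt0n => u0.
case/forall_inPn => v; rewrite inE -lt0n => v0.
rewrite negb_imply => /andP[uv nadj].
have step (x y : G) : x != y -> (0 < w x)%N -> (0 < w y)%N ->
    wcliques c w <= wcliques c (transfer x y w) ->
    exists w' : G -> nat, [/\ clique [set x | w' x != 0%N],
      (\sum_x w' x = \sum_x w x)%N & wcliques c w <= wcliques c w'].
  move=> xy x0 y0 le.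
  have [w' [cl sm le']] :=
    IHN (transfer x y w) (leq_trans (supp_transfer xy x0 y0) wN).
  by exists w'; split=> //; [rewrite sm sum_transfer|apply: le_trans le'].
have [le|lt1] := leP (wcliques c w) (wcliques c (transfer u v w)).
  exact: step le.
apply: (step v u); rewrite // 1?eq_sym //.
rewrite leNgt; apply/negP => lt2.
have := wcliques_transfer c w uv nadj; rewrite natrD => e.
have hu : 0 < (w u)%:R :> rat by rewrite ltr0n.
have hv : 0 < (w v)%:R :> rat by rewrite ltr0n.
move: lt1 lt2; rewrite -(ltr_pM2l hu) => lt1; rewrite -(ltr_pM2l hv) => lt2.
lra.
Qed.

(** A set of vertices that is not a clique leaves the support, so its weight is
    0 and it can be added to the sum. *)
Lemma wcliques_clique_support c (w : G -> nat) :
  clique [set x | w x != 0%N] ->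
  wcliques c w = \sum_(A : {set G}) c #|A| * \prod_(v in A) (w v)%:R.
Proof.
move=> cl; rewrite /wcliques [LHS]big_mkcond; apply: eq_bigr => A _.
case: ifPn => // ncA.
suff [x xA /eqP wx0] : exists2 x, x \in A & w x == 0%N.
  by rewrite (bigD1 x xA) /= wx0 mul0r mulr0.
apply/exists_inP; apply: contraR ncA => /exists_inPn A_supp.
have inS z : z \in A -> z \in [set x | w x != 0%N].
  by move=> zA; rewrite inE A_supp.
apply/forall_inP => x xA; apply/forall_inP => y yA.
exact: (forall_inP (forall_inP cl x (inS x xA)) y (inS y yA)).
Qed.

Lemma wcliques1 (k : nat) :
  wcliques (fun j => (j == k)%:R) (fun=> 1%N) = (nb_cliques k G)%:R.
Proof.
rewrite /wcliques /nb_cliques -sum1_card natr_sum big_mkcond [RHS]big_mkcond.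
apply: eq_bigr => A _; rewrite inE big1 // mulr1.
by case: (clique A) => //=; case: (_ == k).
Qed.

(** The reduction from graphs to integer sequences.  The size of s is made
    exactly r by padding with zeros, to be comparable with the part sizes of
    the Turan graph. *)
Lemma nb_cliques_le_elsym r a b i j : (clique_number G <= r)%N ->
  exists s : seq nat, [/\ size s = r, sumn s = #|G| &
    a * (nb_cliques i G)%:R - b * (nb_cliques j G)%:R <=
    a * elsym i s - b * elsym j s].
Proof.
move=> omega; pose c k : rat := a * (k == i)%:R - b * (k == j)%:R.
have [w [cl sumw le]] := wcliques_le_clique_support c (fun=> 1%N).
pose s := [seq x <- [seq w v | v <- enum G] | x != 0%N].
have size_s : (size s <= r)%N.
  apply: leq_trans omega.
  have -> : size s = #|[set x | w x != 0%N]|.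
    rewrite size_filter count_map cardE size_filter.
    by rewrite -enumT; apply: eq_count => x; rewrite /= inE.
  exact: (@leq_bigmax_cond _ _ (fun A : {set G} => #|A|)).
exists (s ++ nseq (r - size s) 0%N); split.
- by rewrite size_cat size_nseq subnKC.
- rewrite sumn_cat sumn_nseq mul0n addn0 -[RHS]sum1_card -[RHS]sumw sumnE.
  rewrite big_filter big_mkcond big_map big_enum /=.
  by apply: eq_bigr => x _; case: eqP.
have lin f : wcliques c f = a * wcliques (fun k => (k == i)%:R) f
                          - b * wcliques (fun k => (k == j)%:R) f.
  rewrite /wcliques !mulr_sumr -sumrB; apply: eq_bigr => A _.
  by rewrite mulrBl !mulrA.
have ew k : wcliques (fun l => (l == k)%:R) w = elsym k (s ++ nseq (r - size s) 0%N).
  rewrite elsym_cat0 elsym_filter_nz elsym_sum_sets wcliques_clique_support //.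
  rewrite [RHS]big_mkcond; apply: eq_bigr => A _.
  by case: eqP; rewrite ?mul1r ?mul0r.
by move: le; rewrite !lin !wcliques1 !ew.
Qed.

End WeightedCliques.

(** * Cliques of the Turan graph *)

Lemma nb_cliques1 (G : sgraph) : nb_cliques 1 G = #|G|.
Proof.
rewrite -[RHS](card_imset predT (@set1_inj G)); apply: eq_card => A.
rewrite inE; apply/andP/imsetP => [[_ /cards1P[x ->]]|[x _ ->]]; first by exists x.
rewrite cards1; split=> //; apply/forall_inP => y /set1P->.
by apply/forall_inP => z /set1P->; rewrite eqxx.
Qed.

Section InjectiveSets.
Local Open Scope ring_scope.
Variables (T I : finType) (f : T -> I).

(** Expanding the product of the 1 + #|f^-1(i)| X amounts to choosing, for each
    i, either nothing or one point of the fibre of i.  Such choices, encoded as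
    functions to option T, correspond to the sets on which f is injective. *)
Lemma card_inj_sets k :
  #|[set A : {set T} | (#|f @: A| == #|A|) && (#|A| == k)]|%:R =
  elsym k [seq #|[set x | f x == i]| | i <- enum I].
Proof.
pose fits i (o : option T) := if o is Some v then f v == i else true.
pose h (A : {set T}) := [ffun i => [pick v in A | f v == i]].
pose h' (g : {ffun I -> option T}) := [set v | g (f v) == Some v].
have factorE i : 1 + #|[set x | f x == i]|%:R *: 'X =
    \sum_(o | fits i o) 'X^(isSome o) :> {poly rat}.
  rewrite (bigD1 None) //= expr0; congr (_ + _).
  rewrite (reindex_omap Some id) => [|[]//] /=.
  under eq_bigl do rewrite eqxx !andbT.
  rewrite expr1 sumr_const scaler_nat; congr (_ *+ _).
  by apply: eq_card => x; rewrite inE.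
have hfits A : h A \in family fits.
  by apply/familyP => i; rewrite ffunE; case: pickP => // v /andP[].
have h'K g : g \in family fits -> h (h' g) = g.
  move/familyP => gfit; apply/ffunP => i; rewrite ffunE.
  case: pickP => [v|none]; first by rewrite inE => /andP[/eqP gv /eqP<-].
  have := gfit i; rewrite unfold_in; case gi: (g i) => [v|//] /= /eqP fv.
  by have := none v; rewrite inE fv gi !eqxx.
have hK A : (h' (h A) == A) = (#|f @: A| == #|A|).
  apply/eqP/imset_injP => [eA x y|inj].
    rewrite -{1 2}eA !inE !ffunE => /eqP px /eqP py fxy.
    by apply: Some_inj; rewrite -px -py fxy.
  apply/setP => v; rewrite inE ffunE; case: pickP => [x|none].
    move=> /andP[xA /eqP fx]; apply/eqP/idP => [[<-]//|vA].
    by rewrite (inj x v).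
  by apply/esym/negP => vA; have := none v; rewrite vA eqxx.
have sizeh A : (\sum_i isSome (h A i) = #|f @: A|)%N.
  rewrite -sum1_card [RHS]big_mkcond; apply: eq_bigr => i _; rewrite ffunE.
  case: pickP => [v /andP[vA /eqP<-]|none]; first by rewrite imset_f.
  by case: imsetP => // -[v vA e]; have := none v; rewrite vA e eqxx.
rewrite /elsym /elsym_poly big_map big_enum /=.
under eq_bigr do rewrite factorE.
rewrite bigA_distr_big_dep (reindex_onto h h') //= -sum1_card natr_sum coef_sum.
rewrite big_mkcond [RHS]big_mkcond; apply: eq_bigr => A _.
rewrite inE hfits hK prodrXr sizeh coefXn /=.
by case: eqP => //= ->; rewrite eq_sym; case: eqP.
Qed.

End InjectiveSets.

Definition turan_parts n r : seq nat :=
  [seq n %/ r + (c < n %% r) | c <- iota 0 r].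

(** The cliques of the Turan graph are the sets on which reduction modulo r is
    injective. *)
Lemma turan_cliquesE k n r : 0 < r ->
  ((turan_cliques k n r)%:R = elsym k (turan_parts n r))%R.
Proof.
move=> r0; pose f (i : 'I_n) : 'I_r := Ordinal (ltn_pmod i r0).
have -> : turan_parts n r = [seq #|[set x | f x == i]| | i <- enum 'I_r].
  rewrite /turan_parts -val_enum_ord -map_comp; apply: eq_map => c /=.
  by rewrite -card_turan_part; apply: eq_card => x; rewrite !inE.
rewrite -card_inj_sets; congr (_%:R)%R; apply: eq_card => A; rewrite !inE.
congr (_ && _); apply/idP/imset_injP => [cA x y xA yA /(congr1 val) /= e|inj].
  apply/eqP; apply/negPn/negP => ne.
  have /forall_inP/(_ y yA)/implyP/(_ ne) := forall_inP cA x xA.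
  by rewrite /= /turan_adj e eqxx.
apply/forall_inP => x xA; apply/forall_inP => y yA; apply/implyP.
by apply: contra => e; apply/eqP/inj => //; apply/val_inj/eqP.
Qed.

Lemma balanced_turan_parts n r : balanced (turan_parts n r).
Proof.
by move=> x y /mapP[c _ ->] /mapP[d _ ->]; case: (c < _); case: (d < _); lia.
Qed.

Lemma sumn_turan_parts n r : 0 < r -> sumn (turan_parts n r) = n.
Proof.
move=> r0; suff sumE q a m :
    sumn [seq q + (c < a) | c <- iota 0 m] = m * q + minn a m.
  by rewrite sumE (minn_idPl (ltnW (ltn_pmod n r0))) mulnC -divn_eq.
elim: m => [|m IHm]; first by rewrite minn0.
by rewrite -addn1 iotaD map_cat sumn_cat IHm /= add0n; case: ltnP; lia.
Qed.

(** * The chain of ratios *)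

Lemma elsym_turan_parts k n r s : 0 < r -> size s = r -> sumn s = n ->
  k < minn n r ->
  (elsym k.+2 s * (turan_cliques k.+1 n r)%:R <=
   elsym k.+1 s * (turan_cliques k.+2 n r)%:R)%R.
Proof.
move=> r0 ss sn kn.
have t0 : (0 < (turan_cliques k.+1 n r)%:R :> rat)%R.
  by rewrite ltr0n turan_cliques_gt0.
have := @elsym_ratio_le_balanced k s _ (@balanced_turan_parts n r).
rewrite ss sn size_map size_iota sumn_turan_parts // => /(_ erefl erefl).
rewrite /elsym_ratio -!turan_cliquesE // ler_pdivlMr // mulrAC.
have [e0|e0] := eqVneq (elsym k.+1 s) 0%R.
  by rewrite (elsym_eq0S e0) e0 !mul0r.
rewrite ler_pdivrMr; last by rewrite lt_def e0 elsym_ge0.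
by rewrite [leRHS]mulrC.
Qed.

Theorem theorem3p1 (n r : nat) (hn : 1 <= n) (hr : 1 <= r)
    (G : sgraph) (hG : #|G| = n) (hw : clique_number G <= r) :
  let ratio (k : nat) : rat :=
    ((nb_cliques k G)%:R / (turan_cliques k n r)%:R)%R in
  (forall k : nat, 2 <= k <= minn n r -> (ratio k <= ratio k.-1)%R) /\
  (2 <= minn n r -> (ratio 2%N <= 1)%R).
Proof.
move=> ratio.
have chain k : 2 <= k <= minn n r -> (ratio k <= ratio k.-1)%R.
  case: k => [|[|k]] // /andP[_ kn]; rewrite /ratio /=.
  have t0 j : j <= k.+2 -> (0 < (turan_cliques j n r)%:R :> rat)%R.
    by move=> jk; rewrite ltr0n turan_cliques_gt0 // (leq_trans jk).
  rewrite ler_pdivrMr ?t0 // mulrAC ler_pdivlMr ?t0 // -subr_le0.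
  have [s [ss sn le]] := nb_cliques_le_elsym
    (turan_cliques k.+1 n r)%:R (turan_cliques k.+2 n r)%:R k.+2 k.+1 hw.
  rewrite mulrC [X in (_ - X)%R]mulrC; apply: le_trans le _.
  rewrite subr_le0 mulrC [leRHS]mulrC.
  by apply: elsym_turan_parts; rewrite ?sn // ltnW.
split=> // n2; apply: le_trans (chain 2 _) _; first by rewrite n2.
rewrite /ratio /turan_cliques !nb_cliques1 hG card_ord divff //.
by rewrite pnatr_eq0 -lt0n.
Qed.
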